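(* Let $(v_i)_{i\in\mathbb{Z}}$ be a sequence of real numbers, let $i\in\mathbb{Z}$ be such that $\Delta v_{i+1/2}=v_{i+1}-v_i\neq 0$, and put $$\theta^+_i=\frac{v_i-v_{i-1}}{v_{i+1}-v_i},\qquad \theta^-_{i+1}=\frac{v_{i+2}-v_{i+1}}{v_{i+1}-v_i}.$$ Then the SP-WENO weights $w_0,w_1,\widetilde w_0,\widetilde w_1$ at the interface $i+1/2$ (defined in the context) satisfy the consistency property $$0\le w_0,\,w_1,\,\widetilde w_0,\,\widetilde w_1\le 1$$ and the sign property $$\widetilde w_0\,(1-\theta^-_{i+1})+w_1\,(1-\theta^+_i)\ \ge\ 0.$$
   Context: Definition of the SP-WENO weights. Let $\Delta v_{i+1/2}=v_{i+1}-v_i\neq 0$. The weights at the interface $i+1/2$ are $$w_0=\tfrac34+2C_1,\quad w_1=\tfrac14-2C_1,\quad \widetilde w_0=\tfrac14-2C_2,\quad \widetilde w_1=\tfrac34+2C_2,$$ with $C_1=C_1(\theta^+_i,\theta^-_{i+1})$ and $C_2=C_2(\theta^+_i,\theta^-_{i+1})$ given by the following functions. For real $a,b$ with $a\ne 1$ let $\psi^+(a,b)=\frac{1-b}{1-a}$. Let $$f^+(a,b)=\begin{cases}\dfrac{1}{1+\psi^+(a,b)} & \text{if } a\neq 1 \text{ and } \psi^+(a,b)\neq -1,\\ 1 & \text{otherwise,}\end{cases}\qquad f^-(a,b)=f^+(b,a).$$ Then $$C_1(a,b)=\begin{cases}\dfrac18\,\dfrac{f^+(a,b)}{f^+(a,b)^2+f^-(a,b)^2}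 & \text{if } a\ne 1,\ \psi^+(a,b)<0,\ \psi^+(a,b)\neq -1,\\[2mm] 0 & \text{if } a\neq 1,\ \psi^+(a,b)=-1,\\ -\dfrac38 & \text{if } a=1, \text{ or if } a\neq 1,\ \psi^+(a,b)\ge 0 \text{ and } |a|\le 1,\\[1mm] \dfrac18 & \text{if } a\neq 1,\ \psi^+(a,b)\ge 0 \text{ and } |a|>1,\end{cases}$$ and $C_2(a,b)=C_1(b,a)$. The corresponding reconstructed interface values are $v^-_{i+1/2} = w_0(\tfrac{v_i}{2}+\tfrac{v_{i+1}}{2})+w_1(-\tfrac{v_{i-1}}{2}+\tfrac{3v_i}{2})$ and $v^+_{i+1/2} = \widetilde w_0(-\tfrac{v_{i+2}}{2}+\tfrac{3v_{i+1}}{2})+\widetilde w_1(\tfrac{v_i}{2}+\tfrac{v_{i+1}}{2})$, and the quantity in the sign property is related to the reconstructed jump by $v^+_{i+1/2}-v^-_{i+1/2}=\tfrac12[\widetilde w_0(1-\theta^-_{i+1})+w_1(1-\theta^+_i)]\,\Delta v_{i+1/2}$. *)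

(* Defs.v *)
From mathcomp Require Import all_boot all_order all_algebra.
From mathcomp Require Import reals.

Set Implicit Arguments.
Unset Strict Implicit.
Unset Printing Implicit Defensive.

Import Order.TTheory GRing.Theory Num.Theory.
Local Open Scope ring_scope.

Section SPWENO.
Variable R : realType.
Implicit Types (a b : R) (v : int -> R) (i : int).

(* Meaningful only for a != 1; every use below is guarded by that test. *)
Definition psi_plus a b : R := (1 - b) / (1 - a).

Definition f_plus a b : R :=
  if (a != 1) && (psi_plus a b != -1) then 1 / (1 + psi_plus a b) else 1.

Definition f_minus a b : R := f_plus b a.

(* The remaining case of the final [else] is exactly
   a != 1, 0 <= psi_plus a b and 1 < `|a|. *)
Definition C1 a b : R :=
  if [&& a != 1, psi_plus a b < 0 & psi_plus a b != -1] then
    1 / 8 * (f_plus a b / (f_plus a b ^+ 2 + f_minus a b ^+ 2))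
  else if (a != 1) && (psi_plus a b == -1) then 0
  else if (a == 1) || [&& a != 1, 0 <= psi_plus a b & `|a| <= 1] then - (3 / 8)
  else 1 / 8.

Definition C2 a b : R := C1 b a.

(* A quantity attached to the interface i + 1/2 is indexed by i. *)
Definition jump v i : R := v (i + 1) - v i.

(* theta_plus v i is theta^+_i. *)
Definition theta_plus v i : R := (v i - v (i - 1)) / (v (i + 1) - v i).

(* theta_minus v j is theta^-_j; at j = i + 1 it is
   (v_(i+2) - v_(i+1)) / (v_(i+1) - v_i). *)
Definition theta_minus v (j : int) : R :=
  (v (j + 1) - v j) / (v j - v (j - 1)).

Definition w0 v i : R :=
  3 / 4 + 2 * C1 (theta_plus v i) (theta_minus v (i + 1)).

Definition w1 v i : R :=
  1 / 4 - 2 * C1 (theta_plus v i) (theta_minus v (i + 1)).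

Definition wt0 v i : R :=
  1 / 4 - 2 * C2 (theta_plus v i) (theta_minus v (i + 1)).

Definition wt1 v i : R :=
  3 / 4 + 2 * C2 (theta_plus v i) (theta_minus v (i + 1)).

End SPWENO.

(* Main.v *)
Require Import Defs.
From mathcomp Require Import all_boot all_order all_algebra.
From mathcomp Require Import ring lra.
From mathcomp Require Import reals.

Import Order.TTheory GRing.Theory Num.Theory.
Local Open Scope ring_scope.

(** Put x = 1 - a and y = 1 - b. If x y < 0, both C1 and C2 are given by the
    single formulas x (x + y) / (8 (x^2 + y^2)) and y (x + y) / (8 (x^2 + y^2)),
    for which the sign quantity vanishes identically. If x y >= 0, then
    1/4 - 2 C1 is 1 when |a| <= 1 and 0 otherwise, so that each of the two terms
    of the sign quantity is nonnegative by itself. *)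

(** At [a = 1] division by zero gives [psi_plus a b = 0], so both sides are false. *)
Lemma psi_plus_lt0 (R : realType) (a b : R) :
  (psi_plus a b < 0) = ((1 - a) * (1 - b) < 0).
Proof.
rewrite /psi_plus; have [->|x0] := eqVneq (1 - a) 0.
  by rewrite invr0 mulr0 mul0r.
have -> : (1 - b) / (1 - a) = (1 - a) * (1 - b) / (1 - a) ^+ 2 by field.
by rewrite pmulr_llt0 // invr_gt0 exprn_even_gt0.
Qed.

(* At a + b = 2 (where psi^+ = -1) the right-hand side is 0, so the formula
   covers that case of the definition too. *)
Lemma C1_opp_sign (R : realType) (a b : R) : (1 - a) * (1 - b) < 0 ->
  C1 a b = (1 - a) * (1 - a + (1 - b)) / (8 * ((1 - a) ^+ 2 + (1 - b) ^+ 2)).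
Proof.
move=> xy; have x0 : 1 - a != 0 by apply: contraTneq xy => ->; rewrite mul0r ltxx.
have y0 : 1 - b != 0 by apply: contraTneq xy => ->; rewrite mulr0 ltxx.
have a1 : a != 1 by rewrite eq_sym -subr_eq0.
have b1 : b != 1 by rewrite eq_sym -subr_eq0.
have psiN1 c d : 1 - c != 0 ->
    (psi_plus c d == -1 :> R) = (1 - c + (1 - d) == 0).
  move=> c0; rewrite /psi_plus (can2_eq (divfK c0) (mulfK c0)) mulN1r.
  by rewrite -addr_eq0 [1 - d + _]addrC.
rewrite /C1 psi_plus_lt0 xy /f_minus /f_plus a1 b1 !psiN1 //=.
rewrite [1 - b + _]addrC; case: eqVneq => [->|s0] /=.
  by rewrite mulr0 mul0r.
have q0 : (1 - a) ^+ 2 + (1 - b) ^+ 2 != 0.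
  by rewrite gt_eqF // addr_gt0 // exprn_even_gt0.
rewrite /psi_plus; move: (1 - a) (1 - b) x0 y0 s0 q0 => x y x0 y0 s0 q0.
field; rewrite [y + x]addrC x0 y0 q0 s0 /=.
(* What is left is the cleared denominator of [f_plus ^+ 2 + f_minus ^+ 2], namely (x^2 + y^2) (x +
   y)^2. *)
by rewrite !exprMn -mulrDl mulf_neq0 // expf_neq0.
Qed.

(** Here [psi_plus a b] is nonnegative, and the branch [a = 1] merges with the test on [|a|] because
    |1| <= 1. *)
Lemma C1_same_sign (R : realType) (a b : R) : 0 <= (1 - a) * (1 - b) ->
  C1 a b = if `|a| <= 1 then - (3 / 8) else 1 / 8.
Proof.
rewrite leNgt -psi_plus_lt0 -leNgt => psi0.
rewrite /C1 [psi_plus a b < 0]ltNge psi0 andbF.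
have /negPf -> : psi_plus a b != -1 by rewrite gt_eqF // (lt_le_trans _ psi0) ?ltrN10.
rewrite andbF; case: eqVneq => [->|_] //=; by rewrite normr1 lexx.
Qed.

(** Exactly the range of C for which 3/4 + 2 C and 1/4 - 2 C lie in [0, 1]. *)
Lemma C1_bounds (R : realType) (a b : R) : - (3 / 8) <= C1 a b <= 1 / 8.
Proof.
have [xy|xy] := ltP ((1 - a) * (1 - b)) 0; last first.
  by rewrite C1_same_sign //; case: ifP => _; apply/andP; split; lra.
rewrite C1_opp_sign //; set x := 1 - a in xy *; set y := 1 - b in xy *.
have q0 : 0 < 8 * (x ^+ 2 + y ^+ 2) by nra.
(* The bounds reduce to 4 x^2 + x y + 3 y^2 >= 0, a positive definite form, and to x y <= y^2. *)
by apply/andP; split; rewrite ?ler_pdivrMr ?ler_pdivlMr //; nra.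
Qed.

Lemma C1_sign (R : realType) (a b : R) :
  0 <= (1 / 4 - 2 * C1 b a) * (1 - b) + (1 / 4 - 2 * C1 a b) * (1 - a).
Proof.
have [xy|xy] := ltP ((1 - a) * (1 - b)) 0.
  have yx : (1 - b) * (1 - a) < 0 by rewrite mulrC.
  rewrite !C1_opp_sign // [(1 - b) ^+ 2 + _]addrC.
  set x := 1 - a in xy *; set y := 1 - b in xy *.
  have q0 : x ^+ 2 + y ^+ 2 != 0 by rewrite gt_eqF //; nra.
  (* Equality holds: x [C1 a b] + y [C1 b a] = (x + y) / 8. *)
  by rewrite le_eqVlt; apply/orP; left; apply/eqP; field.
have nneg c d : 0 <= (1 - c) * (1 - d) ->
    0 <= (1 / 4 - 2 * C1 c d) * (1 - c) :> R.
  move=> /C1_same_sign ->; case: ifP => [/ler_normlP[_ c1]|_]; lra.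
by rewrite addr_ge0 ?nneg // mulrC.
Qed.

Theorem mainTheorem2 (R : realType) (v : int -> R) (i : int)
    (hjump : jump v i != 0) :
  [/\ 0 <= w0 v i <= 1, 0 <= w1 v i <= 1,
      0 <= wt0 v i <= 1 & 0 <= wt1 v i <= 1] /\
  0 <= wt0 v i * (1 - theta_minus v (i + 1)) + w1 v i * (1 - theta_plus v i).
Proof.
rewrite /w0 /w1 /wt0 /wt1 /C2; split; last exact: C1_sign.
move: (theta_plus v i) (theta_minus v (i + 1)) => a b.
have /andP[l1 u1] := C1_bounds R a b; have /andP[l2 u2] := C1_bounds R b a.
by split; apply/andP; split; lra.
Qed.
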